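(* There exist a universal constant $c>0$ and $q_0$ such that for every integer $q\ge q_0$, every $N\ge 2q+1$, every $d'\ge1$, with $d=d'+q+1$, and all positive integers $m,p$ with $mp\le cq$, there is no $f\in\mathcal{T}^{1,1}_{d,m,d',p}$ that $\frac1{2q}$-approximates the $q$-sparse averaging function $q\mathrm{SA}$.
   Context: Self-attention. For $A\in\mathbb{R}^{N\times M}$, the row-wise softmax is $\mathrm{softmax}(A)_{i,j}=\exp(A_{i,j})/\sum_{j'=1}^M\exp(A_{i,j'})$. For matrices $Q,K\in\mathbb{R}^{d\times m}$, $V\in\mathbb{R}^{d\times d'}$ encoded using $p$-bit fixed-point numbers, a self-attention unit is $f_{Q,K,V}:\mathbb{R}^{N\times d}\to\mathbb{R}^{N\times d'}$, $f_{Q,K,V}(X)=\mathrm{softmax}(XQK^{\mathsf T}X^{\mathsf T})XV$. $\mathcal{A}_{d,m,d',p}$ is the set of all such units. MLP layer. $\Phi_{d,d',p}$ is the set of all (arbitrary) functions $\phi:\mathbb{R}^d\to\mathbb{R}^{d'}$ whose real-valued inputs and outputs can be represented using $p$-bit fixed-precision numbers; $\phi$ is applied row-wise: $\phi(X)=(\phi(x_1),\dots,\phi(x_N))$. Transformer with one layer and one head: $\mathcal{T}^{1,1}_{d,m,d',p}=\Phi_{m,d',p}\,\mathcal{A}_{m,m,m,p}\,\Phi_{d,m,p}$, where concatenation denotes composition (input MLP, then one self-attention unit, then output MLP). Sparse averaging. Let $\mathbb{B}^{d'}$ be the Euclidean unit ball in $\mathbb{R}^{d'}$. Inputs are $X=(x_1,\dots,x_N)\in\mathbb{R}^{N\times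 d}$, $d=d'+q+1$, with $x_i=(z_i;y_i;i)$, $z_i\in\mathbb{B}^{d'}$, $y_i\in\binom{[N]}{q}$ (a $q$-element subset of $[N]=\{1,\dots,N\}$ encoded as a vector in $[N]^q$ with distinct components). Define $q\mathrm{SA}(X)=\left(\frac1q\sum_{j=1}^q z_{y_{i,j}}\right)_{i\in[N]}$. A function $f:\mathbb{R}^{N\times d}\to\mathbb{R}^{N\times d'}$ $\epsilon$-approximates $q\mathrm{SA}$ if for all such $X$, $\max_{i\in[N]}\|f(X)_i-q\mathrm{SA}(X)_i\|_2\le\epsilon$. *)

(* Defs.v *)
From mathcomp Require Import all_boot all_order all_algebra.
From mathcomp Require Import boolp classical_sets reals sequences exp.

Set Implicit Arguments.
Unset Strict Implicit.
Unset Printing Implicit Defensive.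

Import Order.TTheory GRing.Theory Num.Theory.
Local Open Scope classical_set_scope.
Local Open Scope ring_scope.

(* Two's-complement p-bit numbers with an arbitrary position s of the binary
   point: the values k * 2^s with -2^(p-1) <= k < 2^(p-1). *)
Definition fixed_point (R : realType) (p : nat) (s : int) : set R :=
  [set k%:~R * 2 ^ s | k in [set k : int | - 2 ^+ p.-1 <= k < 2 ^+ p.-1]].

Definition fixed_point_mx (R : realType) (p a b : nat) : set 'M[R]_(a, b) :=
  [set A | exists s : int, forall i j, fixed_point p s (A i j)].

Definition softmax (R : realType) (a b : nat) (A : 'M[R]_(a, b)) :
    'M[R]_(a, b) :=
  \matrix_(i, j) (expR (A i j) / \sum_j' expR (A i j')).

Definition attention (R : realType) (N d m d' : nat)
    (Q K : 'M[R]_(d, m)) (V : 'M[R]_(d, d')) (X : 'M[R]_(N, d)) :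
    'M[R]_(N, d') :=
  softmax (X *m Q *m K^T *m X^T) *m X *m V.

Definition attention_units (R : realType) (N d m d' p : nat) :
    set ('M[R]_(N, d) -> 'M[R]_(N, d')) :=
  [set f | exists (Q K : 'M[R]_(d, m)) (V : 'M[R]_(d, d')),
     [/\ fixed_point_mx p Q, fixed_point_mx p K, fixed_point_mx p V
       & f = attention Q K V]].

(* The position of the binary point may differ from one map to another, but is
   the same for all inputs and output coordinates of one map.  The arguments
   that occur below (points of the unit ball, softmax averages) are arbitrary
   reals, so phi is total on R^d; since phi is otherwise arbitrary, the maps
   that depend only on a p-bit rounding of their argument all belong to this
   set. *)
Definition mlps (R : realType) (d d' p : nat) :
    set ('rV[R]_d -> 'rV[R]_d') :=
  [set phi | exists s : int, forall x j, fixed_point p s (phi x 0 j)].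

Definition rowwise (R : realType) (N d d' : nat)
    (phi : 'rV[R]_d -> 'rV[R]_d') (X : 'M[R]_(N, d)) : 'M[R]_(N, d') :=
  \matrix_(i, j) phi (row i X) 0 j.

Definition transformers11 (R : realType) (N d m d' p : nat) :
    set ('M[R]_(N, d) -> 'M[R]_(N, d')) :=
  [set f | exists phi_in g phi_out,
     [/\ mlps p phi_in, @attention_units R N m m m p g, mlps p phi_out
       & f = @rowwise R N m d' phi_out \o g \o @rowwise R N d m phi_in]].

(* The norm that the library puts on matrices is the sup norm. *)
Definition l2norm (R : realType) (n : nat) (v : 'rV[R]_n) : R :=
  Num.sqrt (\sum_j v 0 j ^+ 2).

(* Row i is (z_i; y_i; i).  Positions are elements of 'I_N, counted from 0;
   their encoding as reals is shifted so as to range over 1, ..., N. *)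
Definition qSA_input (R : realType) (N d' q : nat)
    (z : 'M[R]_(N, d')) (y : 'I_N -> 'I_q -> 'I_N) : 'M[R]_(N, d' + q + 1) :=
  row_mx (row_mx z (\matrix_(i, j) (y i j).+1%:R)) (\col_i i.+1%:R).

Definition qSA_valid (R : realType) (N d' q : nat)
    (z : 'M[R]_(N, d')) (y : 'I_N -> 'I_q -> 'I_N) : Prop :=
  forall i, l2norm (row i z) <= 1 /\ injective (y i).

(* The value of qSA at the input matrix qSA_input z y. *)
Definition qSA (R : realType) (N d' q : nat)
    (z : 'M[R]_(N, d')) (y : 'I_N -> 'I_q -> 'I_N) : 'M[R]_(N, d') :=
  \matrix_i (q%:R^-1 *: \sum_j row (y i j) z).

Definition approximates_qSA (R : realType) (N d' q : nat) (eps : R)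
    (f : 'M[R]_(N, d' + q + 1) -> 'M[R]_(N, d')) : Prop :=
  forall z y, qSA_valid z y ->
  forall i, l2norm (row i (f (qSA_input z y)) - row i (qSA z y)) <= eps.

(* Main.v *)
(** Row [2q] of the output depends on [y_{2q}] only through the image of row
    [2q] under the input MLP, which takes at most [2^(mp)] values when [z_{2q}]
    is fixed.  Let [y_{2q}] select one element from each of the pairs
    [{2k, 2k+1}], [k < q]: there are [2^q > 2^(mp)] such selections, so two of
    them, differing on some pair [k], are indistinguishable to the attention
    unit.  Setting [z] to [e_1] and [-e_1] on the pair [k] and to [0] elsewhere
    makes the two averages [e_1/q] and [-e_1/q], which are at distance
    [2/q > 2 * 1/(2q)]. *)
Require Import Defs.
From mathcomp Require Import all_boot all_order all_algebra.
From mathcomp Require Import boolp classical_sets reals sequences exp.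
From mathcomp Require Import zify lra.

Set Implicit Arguments.
Unset Strict Implicit.
Unset Printing Implicit Defensive.

Import Order.TTheory GRing.Theory Num.Theory.
Local Open Scope ring_scope.

(** Adding [2 ^ p.-1] to the integer part lands in [[0, 2 ^ p)]. The decoding map turns real values
    into finite codes that can be counted. *)
Lemma fixed_point_decode (R : realType) (p : nat) (s : int) : (0 < p)%N ->
  exists decode : 'I_(2 ^ p) -> R,
    forall u, fixed_point p s u -> exists k, u = decode k.
Proof.
move=> p0.
exists (fun k => ((k : nat)%:Z - 2 ^+ p.-1)%:~R * 2 ^ s) => u [k /= /andP[k1 k2] <-].
have e : (2 ^ p)%N%:Z = 2 ^+ p.-1 + 2 ^+ p.-1 :> int.
  by rewrite -{1}(prednK p0) expnS mul2n -addnn PoszD -natrX natz.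
have lt : (`|(k + 2 ^+ p.-1)%R| < 2 ^ p)%N by lia.
exists (Ordinal lt) => /=; congr (_%:~R * _).
by rewrite gez0_abs ?addrK //; lia.
Qed.

(** Pigeonhole: as [s] is common to all outputs, [m] codes of [p] bits determine an output row. *)
Lemma mlps_collision (R : realType) (d m p : nat) (phi : 'rV[R]_d -> 'rV[R]_m)
    (T : finType) (x : T -> 'rV[R]_d) :
  (0 < p)%N -> mlps p phi -> (2 ^ (m * p) < #|T|)%N ->
  exists a b, a != b /\ phi (x a) = phi (x b).
Proof.
move=> p0 [s phis] ltT.
have [decode decodeP] := @fixed_point_decode R p s p0.
have /choice[code codeP] : forall a, exists c : {ffun 'I_m -> 'I_(2 ^ p)},
    forall j, phi (x a) 0 j = decode (c j).
  move=> a; have /choice[c cP] := fun j => decodeP _ (phis (x a) j).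
  by exists (finfun c) => j; rewrite ffunE.
have /injectivePn[a [b ab eqab]] : ~~ injectiveb code.
  apply/injectiveP => /leq_card; rewrite card_ffun !card_ord -expnM mulnC.
  by rewrite leqNgt ltT.
by exists a, b; split=> //; apply/rowP => j; rewrite !codeP eqab.
Qed.

Lemma rowwise_eq (R : realType) (N d d' : nat) (phi : 'rV[R]_d -> 'rV[R]_d')
    (X X' : 'M[R]_(N, d)) :
  (forall i, phi (row i X) = phi (row i X')) -> rowwise phi X = rowwise phi X'.
Proof. by move=> e; apply/matrixP => i j; rewrite !mxE e. Qed.

Lemma row_qSA_input (R : realType) (N d' q : nat) (z z' : 'M[R]_(N, d'))
    (y y' : 'I_N -> 'I_q -> 'I_N) (i : 'I_N) :
  row i z = row i z' -> y i =1 y' i ->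
  row i (qSA_input z y) = row i (qSA_input z' y').
Proof.
move=> ez ey; rewrite /qSA_input !row_row_mx ez; congr (row_mx (row_mx _ _) _).
by apply/rowP => j; rewrite !mxE ey.
Qed.

Lemma ler_coord_l2norm (R : realType) (n : nat) (v : 'rV[R]_n) (j : 'I_n) :
  `|v 0 j| <= l2norm v.
Proof.
have sq_ge0 k : 0 <= v 0 k ^+ 2 by apply: sqr_ge0.
rewrite -sqrtr_sqr ler_sqrt; last by apply: sumr_ge0.
by rewrite (bigD1 j) //= lerDl sumr_ge0.
Qed.

Lemma l2norm_scale_delta (R : realType) (n : nat) (a : R) (j : 'I_n) :
  l2norm (a *: delta_mx 0 j) = `|a|.
Proof.
rewrite /l2norm (bigD1 j) //= big1 => [|k /negPf kj].
  by rewrite !mxE !eqxx mulr1 addr0 sqrtr_sqr.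
by rewrite !mxE kj andbF mulr0 expr0n.
Qed.

Section PairSelection.
Variables (q N : nat) (leN : (2 * q < N)%N).

Lemma pair_select_subproof (b : 'I_q -> bool) (k : 'I_q) : (k.*2 + b k < N)%N.
Proof. by have := ltn_ord k; lia. Qed.

Definition pair_select (b : 'I_q -> bool) (k : 'I_q) : 'I_N :=
  Ordinal (pair_select_subproof b k).

Lemma pair_select_inj (b : 'I_q -> bool) : injective (pair_select b).
Proof. by move=> k l /(congr1 val) /= e; apply/val_inj => /=; lia. Qed.

(** Halving a position recovers the index of its pair, and parity recovers the bit. *)
Lemma pair_select_eq (b b' : 'I_q -> bool) (k l : 'I_q) :
  (pair_select b k == pair_select b' l) = (k == l) && (b k == b' l).
Proof.
apply/eqP/andP => [/(congr1 val) /= e|[/eqP-> /eqP e]]; last first.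
  by apply/val_inj; rewrite /= e.
have kl : k = l by apply/val_inj => /=; lia.
by subst l; split=> //; apply/eqP; lia.
Qed.

End PairSelection.

Theorem theorem4 (R : realType) :
  exists (c : R) (q0 : nat), 0 < c /\
  forall q N d' m p : nat,
    (q0 <= q)%N -> (2 * q + 1 <= N)%N -> (1 <= d')%N ->
    (0 < m)%N -> (0 < p)%N -> (m * p)%:R <= c * q%:R ->
    ~ exists f : 'M[R]_(N, d' + q + 1) -> 'M[R]_(N, d'),
        @transformers11 R N (d' + q + 1) m d' p f /\
        approximates_qSA (1 / (2 * q)%:R) f.
Proof.
exists (1 / 2), 1%N; split; first by lra.
move=> q N d' m p q0; rewrite addn1 => leN d'0 _ p0 mpq.
move=> [_ [[phi [g [psi [phiP _ _ ->]]]] approx]].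
have q0R : 0 < q%:R :> R by rewrite ltr0n.
(* The factor 1/2 and [q >= 1] make the inequality strict, as the pigeonhole requires. *)
have {}mpq : (m * p < q)%N by rewrite -(ltr_nat R); lra.
pose i0 := Ordinal leN; pose e := Ordinal d'0.
pose sel := @pair_select q N leN.
(* Only row [i0] carries [b]; the other rows get a fixed valid selection. *)
pose y (b : {ffun 'I_q -> bool}) (i : 'I_N) :=
  if i == i0 then sel b else sel xpred0.
(* The final [z] depends on [b] and [b'], so the collision is sought with [z = 0]; it carries over
   because row [i0] of the final [z] vanishes. *)
have [|b [b' [bb' eq_phi]]] :=
  mlps_collision (fun b => row i0 (@qSA_input R N d' q 0 (y b))) p0 phiP.
  by rewrite card_ffun card_bool card_ord ltn_exp2l.
have [k bk] : exists k, b k != b' k.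
  apply/existsP; apply: contraNT bb' => /existsPn h.
  by apply/eqP/ffunP => k; apply/eqP; rewrite -[_ == _]negbK h.
pose w i : R := (i == sel b k)%:R - (i == sel b' k)%:R.
pose z : 'M[R]_(N, d') := \matrix_i (w i *: delta_mx 0 e).
have i0sel c l : (i0 == sel c l) = false.
  by apply/negbTE/eqP => /(congr1 val) /=; have := ltn_ord l; lia.
have z_i0 : row i0 z = row i0 0.
  by rewrite rowK /w !i0sel subrr scale0r row0.
have valid c : qSA_valid z (y c).
  move=> i; split; last by rewrite /y; case: ifP => _; apply: pair_select_inj.
  rewrite rowK l2norm_scale_delta /w.
  by case: (i == _); case: (i == _); rewrite ?subrr ?subr0 ?sub0r ?normrN ?normr1 ?normr0.
have eq_rows : rowwise phi (qSA_input z (y b)) = rowwise phi (qSA_input z (y b')).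
  apply: rowwise_eq => i; case: (eqVneq i i0) => [->|/negPf ii0].
    by rewrite !(@row_qSA_input _ _ _ _ z 0 _ _ _ z_i0 (frefl _)).
  by congr phi; apply: row_qSA_input => // l; rewrite /y ii0.
(* [w] vanishes outside pair [k], so only the term of index [k] survives. *)
have avg c : qSA z (y c) i0 e = q%:R^-1 * ((c k == b k)%:R - (c k == b' k)%:R).
  rewrite !mxE; congr (_ * _); rewrite summxE (bigD1 k) //= big1 => [|l /negPf lk].
    by rewrite !mxE !eqxx mulr1 addr0 /w /y eqxx !pair_select_eq !eqxx.
  by rewrite !mxE /w /y eqxx !pair_select_eq lk subrr mul0r.
have := le_trans (ler_coord_l2norm _ e) (approx z (y b) (valid b) i0).
have := le_trans (ler_coord_l2norm _ e) (approx z (y b') (valid b') i0).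
rewrite /= eq_rows; set F := rowwise psi _.
have coordB (A B : 'M[R]_(N, d')) :
  (row i0 A - row i0 B) 0 e = A i0 e - B i0 e by rewrite !mxE.
rewrite !coordB !avg !eqxx (negbTE bk) eq_sym (negbTE bk).
rewrite mulr1n sub0r subr0 natrM invfM !ler_norml.
have : 0 < q%:R^-1 :> R by rewrite invr_gt0.
(* The common output [F i0 e] would be at most [-1/(2q)] by the bound for [b'] and at least [1/(2q)]
   by the one for [b]. *)
by move=> ? /andP[_ ?] /andP[? _]; lra.
Qed.
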